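(* Let $p$ be an odd prime and $f(x)\in\mathbb{Z}[x]$. Any periodic orbit of $f$ in $\mathbb{Z}_p$ has length at most $p^2$. If $p>3$, this length is the product of a positive integer not exceeding $p$ and a divisor of $p-1$. If $p=3$, this length is either the product of a positive integer not exceeding $3$ and a divisor of $2$, or equal to $9$; and for $p=3$ the length $9$ does occur for some $f\in\mathbb{Z}[x]$. Moreover, if $f$ is not linear, then $f$ has only finitely many periodic points in $\mathbb{Z}_p$.
   Context: $\mathbb{Z}_p$ is the ring of $p$-adic integers. A periodic orbit of $f$ in $\mathbb{Z}_p$ of length $c$ is a set $\{x,f(x),\dots,f^{c-1}(x)\}$ of $c$ distinct elements of $\mathbb{Z}_p$ with $f^c(x)=x$, where powers denote iterates; its elements are called periodic points. *)

(* Defs.v *)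
From HB Require Import structures.
From mathcomp Require Import all_boot all_order all_algebra.
From mathcomp Require Import boolp classical_sets cardinality.

Set Implicit Arguments.
Unset Strict Implicit.
Unset Printing Implicit Defensive.

Import GRing.Theory.
Local Open Scope ring_scope.

Definition Zp_red (p n : nat) (a : 'Z_(p ^ n.+2)) : 'Z_(p ^ n.+1) :=
  (nat_of_ord a)%:R.

(* Z_p is the inverse limit of the rings Z/p^(n+1), n >= 0, with ring
   operations computed in each component.  The exponents start at 1 because
   'Z_1 is not the zero ring in MathComp.  For p < 2 all the components are
   Z/2, and the type is a ring without significance. *)
Record padic_int (p : nat) := PadicInt {
  padic_res :> forall n, 'Z_(p ^ n.+1);
  padic_resP : forall n, Zp_red (padic_res n.+1) = padic_res n }.

Section PadicRing.
Variable p : nat.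
Implicit Types x y z : padic_int p.

Lemma padic_ext x y : (forall n, x n = y n) -> x = y.
Proof.
case: x y => [x xP] [y yP] /= exy; have {}exy : x = y.
  exact: functional_extensionality_dep.
by subst y; rewrite (Prop_irrelevance xP yP).
Qed.

Lemma Zp_trunc_dvd n :
  ((Zp_trunc (p ^ n.+1)).+2 %| (Zp_trunc (p ^ n.+2)).+2)%N.
Proof.
case: p => [|[|q]]; first by rewrite !exp0n.
  by rewrite !exp1n.
have gt1 k : (1 < q.+2 ^ k.+1)%N by apply: leq_trans (ltn_expl _ _).
by rewrite (Zp_cast (gt1 n)) (Zp_cast (gt1 n.+1)) dvdn_exp2l.
Qed.

Lemma natr_padic_mod n a :
  (a %% (Zp_trunc (p ^ n.+2)).+2)%:R = a%:R :> 'Z_(p ^ n.+1).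
Proof.
by rewrite !Zp_nat; apply: val_inj; rewrite /= modn_dvdm // Zp_trunc_dvd.
Qed.

Fact padic_zero_subproof n : Zp_red (0 : 'Z_(p ^ n.+2)) = 0.
Proof. by []. Qed.

Fact padic_one_subproof n : Zp_red (1 : 'Z_(p ^ n.+2)) = 1.
Proof. by []. Qed.

Lemma Zp_redD n : {morph @Zp_red p n : a b / a + b}.
Proof. by move=> a b; rewrite /Zp_red /= natr_padic_mod natrD. Qed.

Lemma Zp_redM n : {morph @Zp_red p n : a b / a * b}.
Proof. by move=> a b; rewrite /Zp_red /= natr_padic_mod natrM. Qed.

Fact padic_add_subproof x y n : Zp_red (x n.+1 + y n.+1) = x n + y n.
Proof. by rewrite Zp_redD !padic_resP. Qed.

Fact padic_opp_subproof x n : Zp_red (- x n.+1) = - x n.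
Proof.
by apply/eqP; rewrite -addr_eq0 -(padic_resP x n) -Zp_redD addNr.
Qed.

Fact padic_mul_subproof x y n : Zp_red (x n.+1 * y n.+1) = x n * y n.
Proof. by rewrite Zp_redM !padic_resP. Qed.

Definition padic_zero := PadicInt padic_zero_subproof.
Definition padic_one := PadicInt padic_one_subproof.
Definition padic_add x y := PadicInt (padic_add_subproof x y).
Definition padic_opp x := PadicInt (padic_opp_subproof x).
Definition padic_mul x y := PadicInt (padic_mul_subproof x y).

HB.instance Definition _ := gen_eqMixin (padic_int p).
HB.instance Definition _ := gen_choiceMixin (padic_int p).

Fact padic_addA : associative padic_add.
Proof. by move=> x y z; apply: padic_ext => n; exact: addrA. Qed.
Fact padic_addC : commutative padic_add.
Proof. by move=> x y; apply: padic_ext => n; exact: addrC. Qed.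
Fact padic_add0 : left_id padic_zero padic_add.
Proof. by move=> x; apply: padic_ext => n; exact: add0r. Qed.
Fact padic_addN : left_inverse padic_zero padic_opp padic_add.
Proof. by move=> x; apply: padic_ext => n; exact: addNr. Qed.

HB.instance Definition _ := GRing.isZmodule.Build (padic_int p)
  padic_addA padic_addC padic_add0 padic_addN.

Fact padic_mulA : associative padic_mul.
Proof. by move=> x y z; apply: padic_ext => n; exact: mulrA. Qed.
Fact padic_mulC : commutative padic_mul.
Proof. by move=> x y; apply: padic_ext => n; exact: mulrC. Qed.
Fact padic_mul1 : left_id padic_one padic_mul.
Proof. by move=> x; apply: padic_ext => n; exact: mul1r. Qed.
Fact padic_mulD : left_distributive padic_mul padic_add.
Proof. by move=> x y z; apply: padic_ext => n; exact: mulrDl. Qed.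
Fact padic_one_neq0 : padic_one != padic_zero.
Proof. by apply/eqP => /(congr1 (fun x => val (padic_res x 0))). Qed.

HB.instance Definition _ := GRing.Zmodule_isComNzRing.Build (padic_int p)
  padic_mulA padic_mulC padic_mul1 padic_mulD padic_one_neq0.

End PadicRing.

Definition zpoly_fun (R : nzRingType) (f : {poly int}) : R -> R :=
  fun x => (map_poly intr f).[x].

(* traject F x c is the sequence [:: x; F x; ...; iter c.-1 F x]. *)
Definition periodic_orbit (T : eqType) (F : T -> T) (c : nat) (O : set T) :=
  (0 < c)%N /\
  exists x : T, [/\ uniq (traject F x c), iter c F x = x
                  & O = [set` traject F x c]%classic].

Definition periodic_points (T : eqType) (F : T -> T) : set T :=
  [set x | exists c O, periodic_orbit F c O /\ O x]%classic.

(* Main.v *)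
(* Modulo p an orbit has length m <= p, and F = f^m fixes its point x modulo p.
   Put d = F(x) - x and let l be the residue of F'(x): then F^n(x) - x is d
   times an element congruent to 1 + l + ... + l^(n-1).  If l = 0 this forces
   d = 0; if l <> 0, then F^(p-1) has multiplier 1 modulo p, so assume l = 1.
   The above then excludes every period not divisible by p, and a second order
   expansion gives F^p(x) - x = d p (1 + p t) unless p = 3 and p^2 does not
   divide d.  So for p > 3 the point is fixed by F^(p-1).  For p = 3, with l = 1,
   the step of F^3 is divisible by 9, so x is fixed by F^3; with l = -1 the same
   holds for F^2.

   The length 9 is obtained by lifting the point 0 with Hensel's lemma to a zero
   of f^9(X) - X for f = 2 + X + 3X^2 + X^3 + 3X^4 + 2X^5. *)
From HB Require Import structures.
Require Import Defs.
From mathcomp Require Import all_boot all_order all_algebra.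
From mathcomp Require Import boolp classical_sets cardinality.
From mathcomp Require Import cyclic ring zify.

Set Implicit Arguments.
Unset Strict Implicit.
Unset Printing Implicit Defensive.

Section CyclesOverPadicIntegers.

Import GRing.Theory.
Local Open Scope ring_scope.

(** * Residues modulo powers of p, and the absence of zero divisors in Z_p *)

Definition padic_proj p n (x : padic_int p) : 'Z_(p ^ n.+1) := x n.
Arguments padic_proj : simpl never.

Fact padic_proj_zmod p n : zmod_morphism (@padic_proj p n).
Proof. by []. Qed.
Fact padic_proj_monoid p n : monoid_morphism (@padic_proj p n).
Proof. by []. Qed.
HB.instance Definition _ p n :=
  GRing.isZmodMorphism.Build (padic_int p) 'Z_(p ^ n.+1) (@padic_proj p n)
    (@padic_proj_zmod p n).
HB.instance Definition _ p n :=
  GRing.isMonoidMorphism.Build (padic_int p) 'Z_(p ^ n.+1) (@padic_proj p n)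
    (@padic_proj_monoid p n).

Lemma padic_proj_inj p (x y : padic_int p) :
  (forall n, padic_proj n x = padic_proj n y) -> x = y.
Proof. exact: padic_ext. Qed.

Section Padic.
Variables (p : nat) (p_pr : prime p).
Local Notation Zp := (padic_int p).
Implicit Types x y : Zp.

Lemma prime_expn_gt1 n : (1 < p ^ n.+1)%N.
Proof.
apply: leq_trans (prime_gt1 p_pr) _.
by rewrite -{1}[p]expn1 leq_pexp2l // prime_gt0.
Qed.

Lemma natr_Zpexp_eq n a b :
  (a%:R == b%:R :> 'Z_(p ^ n.+1)) = (a == b %[mod p ^ n.+1])%N.
Proof.
by rewrite -val_eqE /= !val_Zp_nat ?prime_expn_gt1.
Qed.

Lemma natr_Zpexp_eq0 n a :
  (a%:R == 0 :> 'Z_(p ^ n.+1)) = (p ^ n.+1 %| a)%N.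
Proof. by rewrite -[0]/(0%:R) natr_Zpexp_eq mod0n. Qed.

Lemma padic_proj_succ n x :
  padic_proj n x = (nat_of_ord (padic_proj n.+1 x))%:R.
Proof. by rewrite /padic_proj -(padic_resP x n). Qed.

Lemma padic_proj_lift n k x :
  padic_proj n x = (nat_of_ord (padic_proj (n + k) x))%:R.
Proof.
elim: k => [|k IHk]; first by rewrite addn0 natr_Zp.
rewrite IHk addnS (padic_proj_succ (n + k)); apply/eqP.
rewrite natr_Zpexp_eq val_Zp_nat ?prime_expn_gt1 // modn_dvdm //.
by rewrite dvdn_exp2l // ltnS leq_addr.
Qed.

Lemma Zpexp_unit n (a : 'Z_(p ^ n.+1)) :
  ((nat_of_ord a)%:R != 0 :> 'Z_(p ^ 1)) -> a \is a GRing.unit.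
Proof.
rewrite natr_Zpexp_eq0 expn1 -{2}[a]natr_Zp unitZpE ?prime_expn_gt1 // => pa.
by rewrite coprime_pexpl // prime_coprime.
Qed.

(** Dividing by p costs one digit: p * y = 0 modulo p^(n+2) gives y = 0 modulo p^(n+1), so each
    residue of y is controlled from the next level. *)
Lemma padic_mulp_eq0 y : p%:R * y = 0 -> y = 0.
Proof.
move=> py0; apply: padic_proj_inj => n; apply/eqP.
rewrite padic_proj_succ rmorph0 natr_Zpexp_eq0 -(dvdn_pmul2l (prime_gt0 p_pr)) -expnS.
rewrite -natr_Zpexp_eq0 natrM natr_Zp -(rmorph_nat (@padic_proj p n.+1)).
by rewrite -rmorphM py0 rmorph0.
Qed.

Lemma padic_proj0_eq0 x : padic_proj 0 x = 0 -> exists y, x = p%:R * y.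
Proof.
(* The quotient modulo p^(n+1) comes from the representative of x modulo p^(n+2), because the
   division by p loses a digit. *)
move=> x0; pose r n := (nat_of_ord (padic_proj n.+1 x) %/ p)%N.
have dvx n : (p %| nat_of_ord (padic_proj n x))%N.
  by rewrite -[X in (X %| _)%N]expn1 -natr_Zpexp_eq0 -(padic_proj_lift 0 n) x0.
have rP n : Zp_red ((r n.+1)%:R : 'Z_(p ^ n.+2)) = (r n)%:R.
  rewrite /Zp_red val_Zp_nat ?prime_expn_gt1 //; apply/eqP.
  rewrite natr_Zpexp_eq modn_dvdm ?dvdn_exp2l // /r (padic_proj_succ n.+1).
  rewrite val_Zp_nat ?prime_expn_gt1 //; move: (nat_of_ord _) => v.
  by rewrite [(p ^ n.+2)%N]expnSr -modn_divl modn_mod.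
exists (PadicInt rP); apply: padic_proj_inj => n.
rewrite rmorphM rmorph_nat /= padic_proj_succ /padic_proj /= -natrM.
by rewrite mulnC divnK.
Qed.

Lemma padic_proj0_neq0_reg x y : padic_proj 0 x != 0 -> x * y = 0 -> y = 0.
Proof.
move=> x0 xy0; apply: padic_proj_inj => n.
have xU: padic_proj n x \is a GRing.unit.
  by apply: Zpexp_unit; rewrite -(padic_proj_lift 0 n).
by apply: (mulrI xU); rewrite -rmorphM xy0 rmorph0 mulr0.
Qed.

(** Induction on a level where x is nonzero. If x is nonzero modulo p, it is a unit at every level;
    otherwise x = p * z, and z is nonzero one level lower. *)
Lemma padic_mulf_eq0 x y : x * y = 0 -> x = 0 \/ y = 0.
Proof.
move=> xy0; case: (pselect (exists n, padic_proj n x != 0)) => [[n nx]|nx]; last first.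
  left; apply: padic_proj_inj => n; rewrite rmorph0; apply/eqP.
  by apply: contra_notT nx => nx; exists n.
right; elim: n => [|n IHn] in x nx xy0 *; first exact: (padic_proj0_neq0_reg nx).
have [x0|] := eqVneq (padic_proj 0 x) 0; last first.
  by move/padic_proj0_neq0_reg; apply.
have [z xz] := padic_proj0_eq0 x0; subst x.
apply: (IHn z); last by apply: padic_mulp_eq0; rewrite mulrA.
apply: contraNneq nx => z0; rewrite rmorphM rmorph_nat /=.
move/eqP: z0; rewrite (padic_proj_succ n) natr_Zpexp_eq0 => z0.
rewrite -[padic_proj n.+1 z]natr_Zp -natrM natr_Zpexp_eq0.
by move: z0; move: (nat_of_ord _) => v; rewrite [(p ^ n.+2)%N]expnS dvdn_pmul2l ?prime_gt0.
Qed.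

Lemma padic_poly_finite_roots (F : {poly Zp}) :
  F != 0 -> finite_set [set x | F.[x] = 0]%classic.
Proof.
move: {2}(size F) (leqnn (size F)) => n; elim: n => [|n IHn] in F *.
  by rewrite leqn0 size_poly_eq0 => ->.
move=> sF F0; case: (pselect (exists x, root F x)) => [[a]|noroot]; last first.
  apply: (@sub_finite_set _ _ set0) => // x /= /rootP Fx.
  by apply: noroot; exists x.
move=> /factor_theorem[G FG].
have G0 : G != 0 by apply: contraNneq F0 => G0; rewrite FG G0 mul0r.
apply: (@sub_finite_set _ _ ([set x | G.[x] = 0] `|` [set a])%classic).
  move=> x /=; rewrite FG hornerM hornerXsubC => /padic_mulf_eq0[|/eqP]; first by left.
  by rewrite subr_eq0 => /eqP; right.
rewrite finite_setU; split; last exact: finite_set1.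
apply: IHn => //.
by move: sF; rewrite FG size_Mmonic ?monicXsubC // size_XsubC addn2.
Qed.

Lemma modp_fermat (a : 'Z_(p ^ 1)) : a != 0 -> a ^+ p.-1 = 1.
Proof.
rewrite -[a]natr_Zp; move: (nat_of_ord a) => {}a.
rewrite natr_Zpexp_eq0 => pa; have ca : coprime a p.
  by rewrite coprime_sym prime_coprime // -[X in (X %| _)%N]expn1.
rewrite -natrX -[RHS]mulr1n; apply/eqP.
by rewrite natr_Zpexp_eq expn1 -totient_prime //; apply/eqP/Euler_exp_totient.
Qed.

End Padic.

(** * Taylor expansion, iterates of polynomials and sums of squares *)

(** The coefficient b plays the role of F''(x)/2, obtained without dividing by 2. It is chosen
    before h, so that one b serves a whole orbit; only K varies with h. *)
Lemma horner_taylor3 (R : comNzRingType) (F : {poly R}) x :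
  exists b, forall h, exists K,
    F.[x + h] = F.[x] + F^`().[x] * h + b * h ^+ 2 + K * h ^+ 3.
Proof.
elim/poly_ind: F => [|F c [b IHF]].
  by exists 0 => h; exists 0; rewrite deriv0 !horner0; ring.
exists (F^`().[x] + b * x) => h; have [K FK] := IHF h.
exists (K * (x + h) + b).
by rewrite derivMXaddC !hornerE /= FK; ring.
Qed.

(** Iterates are kept as polynomials so that statements about F and its derivative can be applied to
    F^n. *)
Definition comp_iter (R : nzRingType) n (F : {poly R}) : {poly R} :=
  iter n (fun G => G \Po F) 'X.

Lemma horner_comp_iter (R : comNzRingType) n (F : {poly R}) x :
  (comp_iter n F).[x] = iter n (horner F) x.
Proof. by elim: n x => [|n IHn] x; rewrite ?hornerX //= horner_comp IHn -iterSr. Qed.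

Lemma deriv_comp_iter (R : comNzRingType) n (F : {poly R}) x :
  (comp_iter n F)^`().[x] = \prod_(i < n) F^`().[iter i (horner F) x].
Proof.
elim: n x => [|n IHn] x; first by rewrite derivX hornerC big_ord0.
rewrite /= deriv_comp hornerM horner_comp IHn big_ord_recl mulrC.
by congr (_ * _); apply: eq_bigr => i _; rewrite -iterSr.
Qed.

Lemma iter_fixed_mul (T : Type) (f : T -> T) m n x :
  iter n f x = x -> iter (m * n) f x = x.
Proof. by move=> fx; elim: m => // m IHm; rewrite mulSn iterD IHm. Qed.

Lemma iter_horner_comp_iter (R : comNzRingType) m n (F : {poly R}) x :
  iter n (horner (comp_iter m F)) x = iter (n * m) (horner F) x.
Proof. by elim: n => //= n ->; rewrite horner_comp_iter mulSn iterD. Qed.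

Lemma sum_squares n : (6 * \sum_(i < n.+1) i ^ 2 = n * n.+1 * (2 * n).+1)%N.
Proof.
elim: n => [|n IHn]; first by rewrite big_ord_recl big_ord0.
by rewrite big_ord_recr mulnDr IHn /=; ring.
Qed.

(** Six times the sum is (p-1)p(2p-1), and p > 3 is coprime to 6. For p = 3 the sum is 5, which is
    why that prime behaves differently. *)
Lemma dvdn_sum_squares p : prime p -> (3 < p)%N -> (p %| \sum_(i < p) i ^ 2)%N.
Proof.
move=> p_pr p3; have p6 : coprime p 6.
  rewrite prime_coprime //; apply/negP => d6; have := @dvdn_leq p 6 isT d6.
  by move: d6; case: p p_pr p3 => [|[|[|[|[|[|[|p]]]]]]].
rewrite -(Gauss_dvdr _ p6); case: p p_pr {p3 p6} => // p _.
by rewrite sum_squares mulnAC dvdn_mull.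
Qed.

(** * Dynamics near a point fixed modulo p *)

Section PadicDynamics.
Variables (p : nat) (p_pr : prime p) (p_odd : odd p).
Local Notation Zp := (padic_int p).
Implicit Types (F : {poly Zp}) (x : Zp).

Lemma proj_horner n F x :
  padic_proj n F.[x] = (map_poly (@padic_proj p n) F).[padic_proj n x].
Proof. by rewrite horner_map. Qed.

Lemma proj_iter_horner n F m x :
  padic_proj n (iter m (horner F) x) =
  iter m (horner (map_poly (@padic_proj p n) F)) (padic_proj n x).
Proof. by elim: m => //= m <-; rewrite proj_horner. Qed.

Lemma proj0_iter_fixed F x n :
  padic_proj 0 F.[x] = padic_proj 0 x ->
  padic_proj 0 (iter n (horner F) x) = padic_proj 0 x.
Proof. by move=> Fx; elim: n => //= n IHn; rewrite proj_horner IHn -proj_horner. Qed.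

Lemma proj0_deriv_comp_iter F x n :
  padic_proj 0 F.[x] = padic_proj 0 x ->
  padic_proj 0 (comp_iter n F)^`().[x] = padic_proj 0 F^`().[x] ^+ n.
Proof.
move=> Fx; rewrite deriv_comp_iter rmorph_prod /=.
rewrite -[in RHS](card_ord n) -prodr_const; apply: eq_bigr => i _.
by rewrite [LHS]proj_horner proj0_iter_fixed // -proj_horner.
Qed.

Lemma padic_proj0_eq x y :
  padic_proj 0 x = padic_proj 0 y -> exists z, x = y + p%:R * z.
Proof.
move=> xy; have /(padic_proj0_eq0 p_pr)[z xyz] : padic_proj 0 (x - y) = 0.
  by rewrite rmorphB /= xy subrr.
by exists z; rewrite -xyz addrC subrK.
Qed.

Lemma padic_proj0p (y : Zp) : padic_proj 0 (p%:R * y) = 0.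
Proof.
rewrite rmorphM rmorph_nat; apply/eqP.
by rewrite (_ : _%:R = 0) ?mul0r //; apply/eqP; rewrite natr_Zpexp_eq0 // expn1.
Qed.

(** With d = F(x) - x, the Taylor expansion at h = d * u replaces u by 1 + F'(x) * u plus a multiple
    of d. As p divides d, the residue of u obeys the recursion of a geometric sum. *)
Lemma iter_displacement F x n :
  padic_proj 0 F.[x] = padic_proj 0 x ->
  exists2 u, iter n (horner F) x = x + (F.[x] - x) * u
           & padic_proj 0 u = \sum_(i < n) padic_proj 0 F^`().[x] ^+ i.
Proof.
move=> Fx; have [b taylor] := horner_taylor3 F x.
elim: n => [|n [u IHn ru]]; first by exists 0; rewrite ?big_ord0 ?rmorph0 ?mulr0 ?addr0.
have [K FK] := taylor ((F.[x] - x) * u); rewrite iterS IHn {}FK.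
pose d := F.[x] - x; have d0 : padic_proj 0 d = 0.
  by rewrite rmorphB /= Fx subrr.
exists (1 + F^`().[x] * u + d * (b * u ^+ 2 + K * d * u ^+ 3)).
  by rewrite /d; ring.
rewrite !rmorphD rmorph1 (rmorphM _ d) rmorphM /=. rewrite d0 mul0r addr0 ru.
rewrite big_ord_recl mulr_sumr.
by congr (_ + _); apply: eq_bigr => i _; rewrite exprS.
Qed.

(** The displacement of F^n is d * u with u nonzero modulo p, hence u is not a zero divisor and d =
    0. *)
Lemma fixed_of_iter_fixed F x n :
  padic_proj 0 F.[x] = padic_proj 0 x ->
  \sum_(i < n) padic_proj 0 F^`().[x] ^+ i != 0 ->
  iter n (horner F) x = x -> F.[x] = x.
Proof.
move=> Fx sum0 Fnx; have [u Fu ru] := iter_displacement n Fx.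
apply/eqP; rewrite -subr_eq0; apply/eqP.
rewrite -ru in sum0; apply: (padic_proj0_neq0_reg p_pr sum0).
by rewrite mulrC; apply: (addrI x); rewrite -Fu Fnx addr0.
Qed.

(** With F(x) = x + p * e, the expansion to second order gives F^p(x) - x = p * e * p * t with t = 1
    modulo p; if this vanishes, so does p * e. *)
Lemma fixed_of_iter_prime F x :
  padic_proj 0 F.[x] = padic_proj 0 x -> padic_proj 0 F^`().[x] = 1 ->
  (3 < p)%N \/ (exists e, F.[x] - x = p%:R ^+ 2 * e) ->
  iter p (horner F) x = x -> F.[x] = x.
Proof.
move=> Fx F'x smallp Fpx; have [b taylor] := horner_taylor3 F x.
have [e eFx] := padic_proj0_eq Fx; have [m F'm] : exists m, F^`().[x] = 1 + p%:R * m.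
  by apply: padic_proj0_eq; rewrite rmorph1.
(* Writing the displacement as p * e * z, each step adds 1 + p * (m * i + b * e * i^2) to z modulo
   p^2, since z = i modulo p. Summation gives the binomial coefficient and the sum of squares. *)
have iterE i : exists k, iter i (horner F) x =
    x + p%:R * e * (i%:R + p%:R * (m * 'C(i, 2)%:R
                             + b * e * (\sum_(j < i) j ^ 2)%N%:R) + p%:R ^+ 2 * k).
  elim: i => [|i [k IHi]].
    by exists 0; rewrite big_ord0 bin0n /=; ring.
  rewrite iterS IHi big_ord_recr binS bin1 /=.
  set w := _ + b * e * _; set z := _ + p%:R ^+ 2 * k.
  have [K ->] := taylor (p%:R * e * z); rewrite F'm eFx.
  exists (k + m * (w + p%:R * k) + b * e * ((i%:R + i%:R) * (w + p%:R * k)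
             + p%:R * (w + p%:R * k) ^+ 2) + K * e ^+ 2 * z ^+ 3).
  by rewrite /z /w !natrD natrX -natr1; ring.
have [k Fk] := iterE p.
(* Oddness of p enters here: p divides 'C(p, 2) only because p > 2. *)
have [c binp] : exists c, 'C(p, 2) = (c * p)%N.
  apply/dvdnP/prime_dvd_bin => //.
  by case: p p_pr p_odd => [|[|[|]]].
(* Either p > 3 and p divides the sum of squares, or p^2 divides p * e and then p divides e. *)
have [s eS] : exists s, e * (\sum_(j < p) j ^ 2)%N%:R = p%:R * s.
  case: smallp => [/(dvdn_sum_squares p_pr)/dvdnP[s ->]|[e' ee']].
    by exists (e * s%:R); rewrite natrM; ring.
  have -> : e = p%:R * e'; last by eexists; rewrite -mulrA.
  apply/eqP; rewrite -subr_eq0; apply/eqP/(padic_mulp_eq0 p_pr).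
  by rewrite mulrBr mulrA -expr2 -ee' eFx; ring.
have pe0 : p%:R * e = 0.
  pose t := 1 + p%:R * (m * c%:R + b * s + k).
  have t0 : padic_proj 0 t != 0.
    by rewrite rmorphD rmorph1 /= padic_proj0p addr0 oner_neq0.
  apply: (padic_proj0_neq0_reg p_pr t0); apply: (padic_mulp_eq0 p_pr).
  apply: (addrI x); rewrite addr0 -[RHS]Fpx Fk binp natrM -[b * e * _]mulrA eS.
  by rewrite /t; ring.
by rewrite eFx pe0 addr0.
Qed.

Lemma proj0_natr_eq0 n : (n%:R == 0 :> 'Z_(p ^ 1)) = (p %| n)%N.
Proof. by rewrite natr_Zpexp_eq0 // expn1. Qed.

(** Both factors of the displacement in [iter_displacement] are divisible by p. This supplies the
    condition that replaces p > 3. *)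
Lemma comp_iter_step_p2 F x m :
  padic_proj 0 F.[x] = padic_proj 0 x ->
  \sum_(i < m) padic_proj 0 F^`().[x] ^+ i = 0 ->
  exists e, (comp_iter m F).[x] - x = p%:R ^+ 2 * e.
Proof.
move=> Fx sum0; have [u Fu ru] := iter_displacement m Fx.
have [e eFx] := padic_proj0_eq Fx.
have /(padic_proj0_eq0 p_pr)[v uv] : padic_proj 0 u = 0 by rewrite ru.
by exists (e * v); rewrite horner_comp_iter Fu eFx uv; ring.
Qed.

(** Strong induction on n. If p does not divide n, the geometric sum is n, nonzero modulo p. If n =
    n' * p, induction applied to F^p and n' shows that F^p fixes x, and [fixed_of_iter_prime]
    concludes. A sum of p ones vanishes modulo p, so F^p meets the condition on p^2 even for p =
    3. *)
Lemma fixed_of_periodic_multiplier1 F x n :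
  padic_proj 0 F.[x] = padic_proj 0 x -> padic_proj 0 F^`().[x] = 1 ->
  (3 < p)%N \/ (exists e, F.[x] - x = p%:R ^+ 2 * e) ->
  (0 < n)%N -> iter n (horner F) x = x -> F.[x] = x.
Proof.
elim/ltn_ind: n F => n IHn F Fx F'x smallp n0 Fnx.
have [/dvdnP[n' n'E]|pn] := boolP (p %| n)%N; last first.
  apply: (fixed_of_iter_fixed Fx _ Fnx); rewrite F'x.
  under eq_bigr do rewrite expr1n.
  by rewrite sumr_const card_ord proj0_natr_eq0.
apply: fixed_of_iter_prime => //; rewrite -horner_comp_iter.
have n'0 : (0 < n')%N by move: n0; rewrite n'E muln_gt0 => /andP[].
apply: (IHn n') => //.
- by rewrite n'E ltn_Pmulr // prime_gt1.
- by rewrite horner_comp_iter proj0_iter_fixed.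
- by rewrite proj0_deriv_comp_iter // F'x expr1n.
- right; apply: comp_iter_step_p2 => //; rewrite F'x.
  under eq_bigr do rewrite expr1n.
  by apply/eqP; rewrite sumr_const card_ord proj0_natr_eq0 // dvdnn.
- by rewrite iter_horner_comp_iter -n'E.
Qed.

End PadicDynamics.

(** * From the residue of the multiplier to a fixed iterate *)

Section PadicPeriods.
Variables (p : nat) (p_pr : prime p) (p_odd : odd p).
Local Notation Zp := (padic_int p).
Implicit Types (F : {poly Zp}) (x : Zp).

(** Only the term 0^0 = 1 of the geometric sum survives. *)
Lemma fixed_of_multiplier0 F x n :
  padic_proj 0 F.[x] = padic_proj 0 x -> padic_proj 0 F^`().[x] = 0 ->
  (0 < n)%N -> iter n (horner F) x = x -> F.[x] = x.
Proof.
move=> Fx F'x; case: n => // n _; apply: fixed_of_iter_fixed => //.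
by rewrite F'x big_ord_recl big1 ?addr0 ?oner_neq0 // => i _; rewrite expr0n.
Qed.

Lemma iter_pred_fixed F x n :
  (3 < p)%N -> padic_proj 0 F.[x] = padic_proj 0 x ->
  (0 < n)%N -> iter n (horner F) x = x -> iter p.-1 (horner F) x = x.
Proof.
move=> p3 Fx n0 Fnx; have [F'x|F'x] := eqVneq (padic_proj 0 F^`().[x]) 0.
  by apply: iter_fix; apply: (fixed_of_multiplier0 Fx F'x n0).
rewrite -horner_comp_iter; apply: (fixed_of_periodic_multiplier1 p_pr p_odd _ _ _ n0) => //.
- by rewrite horner_comp_iter proj0_iter_fixed.
- by rewrite proj0_deriv_comp_iter // modp_fermat.
- by left.
- by rewrite iter_horner_comp_iter mulnC iter_fixed_mul.
Qed.

(** Intended for p = 3: the vanishing sum makes the displacement of F^m divisible by p^2. *)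
Lemma iter_fixed_of_sum0 F x n m :
  padic_proj 0 F.[x] = padic_proj 0 x ->
  padic_proj 0 F^`().[x] ^+ m = 1 ->
  \sum_(i < m) padic_proj 0 F^`().[x] ^+ i = 0 ->
  (0 < n)%N -> iter n (horner F) x = x -> iter m (horner F) x = x.
Proof.
move=> Fx F'm sum0 n0 Fnx; rewrite -horner_comp_iter.
apply: (fixed_of_periodic_multiplier1 p_pr p_odd _ _ _ n0) => //.
- by rewrite horner_comp_iter proj0_iter_fixed.
- by rewrite proj0_deriv_comp_iter.
- by right; apply: comp_iter_step_p2.
- by rewrite iter_horner_comp_iter mulnC iter_fixed_mul.
Qed.

Lemma proj0_return F x c :
  (0 < c)%N -> iter c (horner F) x = x ->
  exists2 m, (0 < m <= p)%N & padic_proj 0 (iter m (horner F) x) = padic_proj 0 x.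
Proof.
case: c => // c _ Fcx; set g := horner (map_poly (@padic_proj p 0) F).
set y := padic_proj 0 x.
(* By these two items of [orbitPcycle], a point with some positive return time returns after [order]
   steps, and [order] is at most the p elements of Z/p. *)
have /(orbitPcycle 3 4) gy : exists k, iter k.+1 g y = y.
  by exists c; rewrite -proj_iter_horner Fcx.
exists (fingraph.order g y); last by rewrite proj_iter_horner.
rewrite order_gt0 /=; apply: leq_trans (max_card _) _.
by rewrite card_ord Zp_cast ?prime_expn_gt1 // expn1.
Qed.

End PadicPeriods.

(** The multiplier modulo 3 is 0, 1 or -1. In the last two cases the vanishing sums are 1 + 1 + 1
    and 1 + (-1), which give the iterates 3 and 2. *)
Lemma iter3_or_iter2_fixed (F : {poly padic_int 3}) x n :
  padic_proj 0 F.[x] = padic_proj 0 x -> (0 < n)%N -> iter n (horner F) x = x ->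
  iter 2 (horner F) x = x \/ iter 3 (horner F) x = x.
Proof.
move=> Fx n0 Fnx.
have [F'x|[F'x|F'x]] : padic_proj 0 F^`().[x] = 0 \/
    padic_proj 0 F^`().[x] = 1 \/ padic_proj 0 F^`().[x] = -1.
- move: (padic_proj 0 _) => a; have: (nat_of_ord a < 3)%N by case: a.
  case: a => -[|[|[|]]] // lt3 _; [left|right; left|right; right]; exact: val_inj.
- by left; apply: iter_fix; apply: (fixed_of_multiplier0 _ Fx F'x n0).
- right; apply: (iter_fixed_of_sum0 _ _ Fx _ _ n0) => //; rewrite F'x ?expr1n //.
  by rewrite !big_ord_recl big_ord0; apply: val_inj.
- left; apply: (iter_fixed_of_sum0 _ _ Fx _ _ n0) => //; rewrite F'x ?sqrrN ?expr1n //.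
  by rewrite !big_ord_recl big_ord0; apply: val_inj.
Qed.

(** * Possible lengths of orbits *)

Lemma dvdn_period (T : eqType) (f : T -> T) x c n :
  (0 < c)%N -> uniq (traject f x c) -> iter c f x = x -> iter n f x = x -> (c %| n)%N.
Proof.
move=> c0 uc fc; rewrite {1}(divn_eq n c) addnC iterD iter_fixed_mul // => fr.
have rc : (n %% c < c)%N by rewrite ltn_mod.
rewrite /dvdn -(nth_uniq x _ _ uc) ?size_traject //.
by rewrite !nth_traject // fr.
Qed.

Lemma zpoly_fun_comp_iter (R : comNzRingType) (f : {poly int}) n (x : R) :
  zpoly_fun (comp_iter n f) x = iter n (zpoly_fun f) x.
Proof.
rewrite -[RHS](horner_comp_iter n (map_poly intr f)); congr _.[x].
by elim: n => [|n IHn]; rewrite ?map_polyX //= map_comp_poly IHn.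
Qed.

Lemma zpoly_fun_subX (R : comNzRingType) (f : {poly int}) (x : R) :
  zpoly_fun (f - 'X) x = zpoly_fun f x - x.
Proof. by rewrite /zpoly_fun rmorphB /= map_polyX hornerD hornerN hornerX. Qed.

Section PeriodicOrbit.
Variables (p : nat) (p_pr : prime p) (p_odd : odd p) (f : {poly int}).
Variables (c : nat) (x : padic_int p).
Hypotheses (c_gt0 : (0 < c)%N) (x_uniq : uniq (traject (zpoly_fun f) x c)).
Hypothesis x_per : iter c (zpoly_fun f) x = x.

Lemma period_dvdn_of_comp m n :
  iter n (horner (comp_iter m (map_poly intr f))) x = x -> (c %| n * m)%N.
Proof. by rewrite iter_horner_comp_iter; apply: dvdn_period. Qed.

Lemma comp_iter_periodic m :
  iter c (horner (comp_iter m (map_poly intr f))) x = x.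
Proof. by rewrite iter_horner_comp_iter mulnC iter_fixed_mul. Qed.

Lemma period_dvdn : (3 < p)%N -> exists2 m, (0 < m <= p)%N & (c %| p.-1 * m)%N.
Proof.
move=> p3; have [m mp xm] := proj0_return p_pr c_gt0 x_per; exists m => //.
apply: period_dvdn_of_comp.
apply: (iter_pred_fixed p_pr p_odd p3 _ c_gt0 (comp_iter_periodic m)).
by rewrite horner_comp_iter.
Qed.

Lemma period_prod : (3 < p)%N ->
  exists m d, [/\ (0 < m <= p)%N, (d %| p.-1)%N & c = (m * d)%N].
Proof.
move=> p3; have [m /andP[m0 mp] cm] := period_dvdn p3.
(* The cofactor c / gcd(c, m) divides (p-1) * (m / gcd(c, m)) and is coprime to the second factor,
   so it divides p-1. *)
exists (gcdn c m), (c %/ gcdn c m)%N; split.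
- by rewrite gcdn_gt0 m0 orbT (leq_trans _ mp) // dvdn_leq // dvdn_gcdr.
- have g0 : (0 < gcdn c m)%N by rewrite gcdn_gt0 c_gt0.
  have co : coprime (c %/ gcdn c m) (m %/ gcdn c m).
    by rewrite /coprime -(eqn_pmul2r g0) muln_gcdl !divnK ?dvdn_gcdl ?dvdn_gcdr // mul1n.
  rewrite -(Gauss_dvdl _ co) -(dvdn_pmul2r g0) -mulnA.
  by rewrite !divnK ?dvdn_gcdl ?dvdn_gcdr.
- by rewrite mulnC divnK // dvdn_gcdl.
Qed.

End PeriodicOrbit.

(** The return time m modulo 3 is at most 3 and c divides 2m or 3m. This leaves 1, 2, 3, 4, 6 and 9,
    of which only 9 is not such a product. *)
Lemma period_three (f : {poly int}) c (x : padic_int 3) :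
  (0 < c)%N -> uniq (traject (zpoly_fun f) x c) -> iter c (zpoly_fun f) x = x ->
  (exists m d : nat, [/\ (0 < m <= 3)%N, (d %| 2)%N & c = (m * d)%N]) \/ c = 9.
Proof.
move=> c0 xu xc; have [m /andP[m0 m3] xm] := @proj0_return 3 isT (map_poly intr f) x c c0 xc.
have mx : padic_proj 0 (comp_iter m (map_poly intr f)).[x] = padic_proj 0 x.
  by rewrite horner_comp_iter.
have : (c %| 2 * m)%N || (c %| 3 * m)%N.
  by apply/orP; case: (iter3_or_iter2_fixed mx c0 (comp_iter_periodic xc m)) => H;
    [left|right]; apply: (period_dvdn_of_comp c0 xu xc H).
have c9 : (c %| 2 * m)%N || (c %| 3 * m)%N -> (c <= 9)%N by case/orP => /dvdn_leq; lia.
move=> cm; have {c9} := c9 cm.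
case: m m0 m3 cm {xm mx} => [|[|[|[|]]]] // _ _;
  case: c c0 {xu xc} => [|[|[|[|[|[|[|[|[|[|]]]]]]]]]] // _ _ _;
  do ?[by right]; left.
all: try by exists 1%N, 1%N.
all: try by exists 2%N, 1%N.
all: try by exists 3%N, 1%N.
all: try by exists 2%N, 2%N.
all: try by exists 3%N, 2%N.
Qed.

Lemma periodic_orbit_le (p : nat) (f : {poly int}) c (x : padic_int p) :
  prime p -> odd p -> (0 < c)%N -> uniq (traject (zpoly_fun f) x c) ->
  iter c (zpoly_fun f) x = x -> (c <= p ^ 2)%N.
Proof.
move=> p_pr p_odd c0 xu xc.
case: (ltnP 3 p) => p3.
  have [m /andP[m0 mp] /dvdn_leq cm] := period_dvdn p_pr p_odd c0 xu xc p3.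
  have := prime_gt0 p_pr; have := prime_gt1 p_pr; nia.
have p_eq3 : p = 3 by case: p p_pr p_odd p3 {x xu xc} => [|[|[|[|]]]].
subst p; have [[m [d [/andP[_ m3] /dvdn_leq d2 ->]]]|->] := period_three c0 xu xc.
  by have := d2 isT; nia.
by [].
Qed.

(** * Finiteness of the set of periodic points *)

Lemma padic_natr_eq0 p n : prime p -> n%:R = 0 :> padic_int p -> n = 0%N.
Proof.
move=> p_pr n0; have: padic_proj n (n%:R : padic_int p) = 0 by rewrite n0 rmorph0.
rewrite rmorph_nat => /eqP; rewrite natr_Zpexp_eq0 //.
case: n n0 => // n _ /dvdn_leq-/(_ isT); rewrite leqNgt.
by rewrite (leq_trans (ltn_expl _ (prime_gt1 p_pr))) // leq_exp2l ?prime_gt1.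
Qed.

Lemma padic_intr_eq0 p (n : int) : prime p -> n%:~R = 0 :> padic_int p -> n = 0.
Proof.
move=> p_pr; case: n => n; first by move/(padic_natr_eq0 p_pr) ->.
by move/eqP; rewrite NegzE rmorphN oppr_eq0 => /eqP/(padic_natr_eq0 p_pr).
Qed.

(** Degrees multiply under composition, so equality would force deg(f)^n = 1. Constants, zero
    included, count as degree 0 here. *)
Lemma comp_iter_neqX (f : {poly int}) n :
  (0 < n)%N -> size f != 2 -> comp_iter n f != 'X.
Proof.
move=> n0 sf; apply/eqP => fX; have: ((size f).-1 ^ n = 1)%N.
  transitivity (size (comp_iter n f)).-1; last by rewrite fX size_polyX.
  elim: n {n0 fX} => [|n IHn]; first by rewrite size_polyX.
  by rewrite /= size_comp_poly -IHn expnSr.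
case: (size f) sf => [|[|[|s]]] //= _; rewrite ?exp0n // => sn.
by have := ltn_expl n (isT : 1 < s.+2)%N; rewrite sn ltnS leqNgt n0.
Qed.

(** Every orbit length is at most p^2 and so divides N = (p^2)!. All periodic points are therefore
    roots of the single nonzero polynomial f^N - X. *)
Lemma finite_periodic_points p (f : {poly int}) :
  prime p -> odd p -> size f != 2 ->
  finite_set (periodic_points (zpoly_fun f : padic_int p -> padic_int p)).
Proof.
move=> p_pr p_odd sf; pose N := (p ^ 2)`!.
have G0 : map_poly intr (comp_iter N f - 'X) != 0 :> {poly padic_int p}.
  apply/eqP => G0; have /eqP := @comp_iter_neqX f N (fact_gt0 _) sf; apply.
  apply/eqP; rewrite -subr_eq0; apply/eqP/polyP => i; rewrite coef0.
  apply: (padic_intr_eq0 p_pr); move/polyP/(_ i): G0.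
  by rewrite coef_map coef0.
apply: sub_finite_set (padic_poly_finite_roots p_pr G0) => x [c [O [[c0 [y [yu yc ->]]]]]].
move=> /trajectP[i ic ->] /=.
have cN : (c %| N)%N by apply: dvdn_fact; rewrite c0 (periodic_orbit_le p_pr p_odd c0 yu yc).
rewrite -[LHS]/(zpoly_fun (comp_iter N f - 'X) _) zpoly_fun_subX zpoly_fun_comp_iter.
by rewrite -iterD addnC iterD -(divnK cN) iter_fixed_mul // subrr.
Qed.

(** * Hensel's lemma *)

Section Hensel.
Variables (p : nat) (p_pr : prime p).

Lemma natr_expp_eq0 m n : (n < m)%N -> p%:R ^+ m = 0 :> 'Z_(p ^ n.+1).
Proof. by move=> nm; rewrite -natrX; apply/eqP; rewrite natr_Zpexp_eq0 // dvdn_exp2l. Qed.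

Lemma intr_Zpexp_eq0 n (a : int) :
  a%:~R = 0 :> 'Z_(p ^ n.+1) -> exists b, a = p%:R ^+ n.+1 * b.
Proof.
move=> a0; suff /dvdzP[b ->] : ((p ^ n.+1)%:Z %| a)%Z.
  by exists b; rewrite mulrC -natrX natz.
rewrite dvdzE /= -natr_Zpexp_eq0 //.
case: a a0 => m /=; first by move/eqP.
by rewrite NegzE rmorphN => /eqP; rewrite oppr_eq0.
Qed.

Lemma padic_limit (s : nat -> int) e :
  (forall n, exists t, s n.+1 = s n + p%:R ^+ (e + n).+1 * t) ->
  exists z : padic_int p, (forall n, padic_proj n z = (s n)%:~R)
                          /\ padic_proj e z = (s 0%N)%:~R.
Proof.
move=> sP; have modS n k : (k <= e + n)%N -> (s n.+1)%:~R = (s n)%:~R :> 'Z_(p ^ k.+1).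
  move=> kn; have [t ->] := sP n.
  by rewrite rmorphD rmorphM rmorphXn rmorph_nat /= natr_expp_eq0 ?mul0r ?addr0.
have rP n : Zp_red ((s n.+1)%:~R : 'Z_(p ^ n.+2)) = (s n)%:~R.
  rewrite -(modS n n (leq_addl _ _)) -!(rmorph_int (@padic_proj p _)).
  exact: padic_resP.
exists (PadicInt rP); split=> //; rewrite [LHS]/((s e)%:~R).
have H n : (s n)%:~R = (s 0%N)%:~R :> 'Z_(p ^ e.+1).
  by elim: n => // n <-; apply: modS; apply: leq_addr.
exact: H.
Qed.

(** The derivative may be divisible by p^e, as happens in the application, where e = 3. *)
Lemma hensel (G : {poly int}) (a c u : int) e :
  G.[a] = p%:R ^+ e.*2.+1 * c -> G^`().[a] = p%:R ^+ e * u -> coprimez p u ->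
  exists2 z : padic_int p, zpoly_fun G z = 0 & padic_proj e z = a%:~R.
Proof.
move=> Ga G'a /coprimezP[[w v] /= wv].
(* Newton's iteration, with v, an inverse of u modulo p, in place of 1 / u *)
pose s n := iter n (fun b => b - v * (G.[b] %/ p%:R ^+ e)%Z) a.
have pn0 k : p%:R ^+ k != 0 :> int.
  by rewrite expf_neq0 // Num.Theory.pnatr_eq0 -lt0n prime_gt0.
(* Each step gains one factor p in G(s n), while G'(s n) changes only by multiples of p^(e+1) and
   keeps the form p^e times a unit modulo p. *)
have inv n : exists c, exists t,
    [/\ G.[s n] = p%:R ^+ (e.*2.+1 + n) * c, G^`().[s n] = p%:R ^+ e * (u + p%:R * t)
      & s n.+1 = s n - v * p%:R ^+ (e + n).+1 * c].
  have next b m d : G.[b] = p%:R ^+ (e.*2.+1 + m) * d ->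
      b - v * (G.[b] %/ p%:R ^+ e)%Z = b - v * p%:R ^+ (e + m).+1 * d.
    move=> ->; rewrite (_ : _ * d = v * 0 + p%:R ^+ (e + m).+1 * d * p%:R ^+ e).
      by rewrite mulr0 add0r mulzK //; ring.
    by rewrite mulr0 add0r -mul2n !mul2n -addnn !exprS !exprD; ring.
  elim: n => [|n [d [t [Gs G's ss]]]].
    exists c, 0; split; rewrite ?addn0 ?mulr0 ?addr0 //.
    by rewrite /s /= (next a 0%N c) ?addn0.
  have [b taylor] := horner_taylor3 G (s n).
  have [b' taylor'] := horner_taylor3 G^`() (s n).
  pose h := - (v * p%:R ^+ (e + n).+1 * d).
  have [K GK] := taylor h; have [K' GK'] := taylor' h.
  have vu : 1 - v * u = w * p%:R by rewrite -[X in X - _]wv natz; ring.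
  (* The linear terms leave the factor 1 - v * u - v * p * t, divisible by p as v inverts u; the
     quadratic and cubic ones contain h^2, of order 2e + 2n + 2. *)
  have GsS : G.[s n.+1] = p%:R ^+ (e.*2.+1 + n.+1) *
       (d * (w - v * t) + p%:R ^+ n * v ^+ 2 * d ^+ 2 * (b + K * h)).
    rewrite ss -/h GK Gs G's.
    transitivity (p%:R ^+ (e.*2.+1 + n) * (d * (1 - v * u - v * p%:R * t)
          + p%:R ^+ n.+1 * v ^+ 2 * d ^+ 2 * (b + K * h))).
      by rewrite /h -!addnn !addSn !exprS !exprD; ring.
    by rewrite vu addnS !exprS; ring.
  eexists; exists (t - p%:R ^+ n * v * d * (G^`()^`().[s n] + b' * h + K' * h ^+ 2)).
  split; first exact: GsS.
    by rewrite ss -/h GK' G's /h !exprS !exprD; ring.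
  exact: next GsS.
have [|z [zs za]] := @padic_limit s e.
  move=> n; have [d [t [_ _ ->]]] := inv n; exists (- v * d); ring.
exists z => //; apply: padic_proj_inj => n; rewrite rmorph0.
have [d [t [Gs _ _]]] := inv n.
rewrite [LHS]proj_horner zs -(rmorph_int (@padic_proj p n)) -proj_horner.
rewrite horner_map rmorph_int Gs rmorphM rmorphXn rmorph_nat /=.
by rewrite natr_expp_eq0 ?mul0r // addSn ltnS leq_addl.
Qed.

End Hensel.

(** * An orbit of length 9 in Z_3 *)

(* Found by a computer search. *)
Definition poly9 : {poly int} := Poly [:: 2; 1; 3; 1; 3; 2].

(** Horner's scheme on an explicit list can be run by [vm_compute] in a ring of residues. *)
Lemma intr_poly9 (R : comNzRingType) (a : int) :
  (poly9.[a])%:~R = horner_rec [:: 2; 1; 3; 1; 3; 2] a%:~R :> R.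
Proof. by rewrite horner_Poly /=; ring. Qed.

Lemma deriv_poly9 : poly9^`() = Poly [:: 1; 6; 3; 12; 10].
Proof.
apply/polyP => i; rewrite coef_deriv !coef_Poly.
by case: i => [|[|[|[|[|i]]]]] //=; rewrite nth_nil mul0rn.
Qed.

Lemma intr_deriv_poly9 (R : comNzRingType) (a : int) :
  (poly9^`().[a])%:~R = horner_rec [:: 1; 6; 3; 12; 10] a%:~R :> R.
Proof. by rewrite deriv_poly9 horner_Poly /=; ring. Qed.

Lemma intr_iter_poly9 (R : comNzRingType) n (a : int) :
  (iter n (horner poly9) a)%:~R =
  iter n (horner_rec [:: 2; 1; 3; 1; 3; 2]) a%:~R :> R.
Proof. by elim: n => //= n <-; rewrite intr_poly9. Qed.

(** The exponent 7 = 2 * 3 + 1 is what [hensel] asks for when e = 3. The check runs in Z/3^7,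
    because the integers f^i(0) grow doubly exponentially. *)
Lemma comp_iter9_poly9_0 :
  exists c, (comp_iter 9 poly9 - 'X).[0] = 3%:R ^+ 7 * c.
Proof.
apply: (@intr_Zpexp_eq0 3 isT 6).
rewrite hornerD hornerN hornerX subr0 horner_comp_iter intr_iter_poly9.
by apply/eqP; vm_compute.
Qed.

Lemma deriv_comp_iter9_poly9_0 :
  exists u, (comp_iter 9 poly9 - 'X)^`().[0] = 3%:R ^+ 3 * u /\ coprimez 3 u.
Proof.
rewrite derivB derivX hornerD hornerN hornerC deriv_comp_iter.
(* Modulo 81 the multiplier is 55; since 54 = 27 * 2, the derivative of f^9 - X at 0 is 27 * (2 +
   3t). *)
have [t tE] : exists t, \prod_(i < 9) poly9^`().[iter i (horner poly9) 0] - 1 - 54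
   = 3%:R ^+ 4 * t.
  apply: (@intr_Zpexp_eq0 3 isT 3); rewrite !rmorphB /= rmorph_prod /=.
  under eq_bigr do rewrite intr_deriv_poly9 intr_iter_poly9.
  by rewrite !big_ord_recr big_ord0; apply/eqP; vm_compute.
exists (2 + 3 * t); split.
  by rewrite -[LHS](subrK 54) tE; ring.
by apply/coprimezP; exists (1 + t, -1) => /=; ring.
Qed.

Lemma exists_orbit9 : exists (f : {poly int}) (O : set (padic_int 3)),
  periodic_orbit (zpoly_fun f) 9 O.
Proof.
have [c cE] := comp_iter9_poly9_0; have [u [uE cu]] := deriv_comp_iter9_poly9_0.
have [z Gz z0] := @hensel 3 isT _ 0 c u 3 cE uE cu.
have z_per : iter 9 (zpoly_fun poly9) z = z.
  by rewrite -zpoly_fun_comp_iter -[LHS](subrK z) -zpoly_fun_subX Gz add0r.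
exists poly9, [set` traject (zpoly_fun poly9) z 9]%classic; split=> //; exists z; split=> //.
(* Distinctness is visible modulo 9, where z = 0 and the first nine iterates of 0 exhaust the
   residues. *)
have zi i : padic_proj 1 (iter i (zpoly_fun poly9) z) =
    iter i (horner_rec [:: 2; 1; 3; 1; 3; 2]) 0.
  have z1 : padic_proj 1 z = padic_proj 1 ((0 : int)%:~R : padic_int 3).
    by rewrite (padic_proj_lift _ 1 2) // z0 rmorph_int.
  transitivity (padic_proj 1 ((iter i (horner poly9) 0)%:~R : padic_int 3)).
    rewrite -zpoly_fun_comp_iter /zpoly_fun proj_horner z1 -proj_horner.
    by rewrite horner_map horner_comp_iter.
  by rewrite rmorph_int intr_iter_poly9.
apply: (@map_uniq _ _ (@padic_proj 3 1)); rewrite [map _ _]/=.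
rewrite (zi 0%N) (zi 1%N) (zi 2%N) (zi 3%N) (zi 4%N) (zi 5%N).
rewrite (zi 6%N) (zi 7%N) (zi 8%N).
by vm_compute.
Qed.

End CyclesOverPadicIntegers.

Theorem mainTheorem9 :
  (forall (p : nat) (f : {poly int}), prime p -> odd p ->
     (forall (c : nat) (O : set (padic_int p)),
        periodic_orbit (zpoly_fun f) c O ->
        [/\ c <= p ^ 2,
            3 < p ->
              exists m d : nat, [/\ 0 < m <= p, d %| p.-1 & c = m * d]
          & p = 3 ->
              (exists m d : nat, [/\ 0 < m <= 3, d %| 2 & c = m * d])
              \/ c = 9]) /\
     (size f != 2 ->
        finite_set (periodic_points (zpoly_fun f : padic_int p -> padic_int p))))
  /\
  (exists (f : {poly int}) (O : set (padic_int 3)),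
     periodic_orbit (zpoly_fun f) 9 O).
Proof.
split; last exact: exists_orbit9.
move=> p f p_pr p_odd; split; last exact: finite_periodic_points.
move=> c O [c0 [x [xu xc _]]]; split.
- exact: periodic_orbit_le xu xc.
- exact: period_prod xu xc.
- by move=> p3; subst p; apply: period_three xu xc.
Qed.
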